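(* Let $(k_0,k_1,\dots,k_n)\in\mathbb{N}^{n+1}$, let $G=\mathrm{oru}(k_0,k_1,\dots,k_n)$ be the multioruga graph with its natural framing $F$, and let $\mathrm{h}$ be the route-counting function, $\mathrm{h}(R)=$ number of routes of $G$ lying geometrically (weakly) below $R$, including $R$ itself. The corresponding tropical framingtope $\mathscr{P}^{\mathrm h}_{G,F}$ has one vertex for each multipermutation $\delta\in\mathfrak{S}_{\mathbf K}$ of type $\mathbf{K}=(k_0,\dots,k_n)$, with coordinates $\mathbf{x}(\delta)=(x_{i,j})$, where $i\in\{1,\dots,n\}$ and $j\in\{1,\dots,k_i\}$, given by $$x_{i,j}=\sum_{p=1}^{j}\ \prod_{\substack{0\le k\le n\\ k\neq i}}\bigl(a_{i,p}^k+1\bigr),$$ where $a_{i,p}^k=a_{i,p}^k(\delta)$ is the number of letters $k$ occurring in $\delta$ up to the $p$-th letter $i$.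
   Context: Multioruga graph. $\mathrm{oru}(\mathbf K)$ has vertices $v_0,\dots,v_{n+1}$ and exactly $k_i+1$ edges from $v_i$ to $v_{i+1}$ for each $i\in\{0,\dots,n\}$. It is drawn in the plane without crossings, vertices from left to right, edges monotone from left to right; the natural framing $F$ orders incoming and outgoing edges at each vertex from top to bottom. The outgoing edges of $v_i$ are labeled $e_{i,0},\dots,e_{i,k_i}$ from bottom to top. A route is a directed path from $v_0$ to $v_{n+1}$, written $[e_{0,b_0},e_{1,b_1},\dots,e_{n,b_n}]$ with $0\le b_i\le k_i$; a route $[e_{0,b_0},\dots,e_{n,b_n}]$ lies weakly below $[e_{0,c_0},\dots,e_{n,c_n}]$ iff $b_k\le c_k$ for all $k$. Coherence and cliques. Two routes are coherent with respect to $F$ if they do not cross, i.e. there is no pair of indices at which one route lies strictly above the other at the first index and strictly below it at the second; a maximal clique is an inclusion-maximal set of pairwise coherent routes. Multipermutations. A multipermutation of type $\mathbf K$ is a word $\delta$ containing each letter $i\in\{0,\dots,n\}$ exactly $k_i$ times; $\mathfrak{S}_{\mathbf K}$ is the set of these. They are in bijection with maximal cliques: $C_\delta$ starts with the bottom route $[e_{0,0},\dots,e_{n,0}]$ and, reading $\delta$ from left to right, for each letter $l$ adds the route obtained from the previous one by replacing its edge $e_{l,s}$ by $e_{l,s+1}$, where $s$ is the number of earlier occurrences of $l$. Tropical framingtope. Let $I=\{(i,j):1\le i\le n,\ 1\le j\le k_i\}$. For each source edge $e_{0,b}$, $0\le b\le k_0$, let $$T_b^{\mathrm h}(\mathbf{x})=\min\Bigl\{-\mathrm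 h([e_{0,b},e_{1,b_1},\dots,e_{n,b_n}])+\sum_{1\le i\le n,\ b_i\neq0}x_{i,b_i}\ :\ 0\le b_i\le k_i\Bigr\},\qquad \mathbf{x}\in\mathbb{R}^I.$$ Each $T_b^{\mathrm h}$ decomposes $\mathbb{R}^I$ into polyhedral cells according to which terms attain the minimum. $\mathscr{P}^{\mathrm h}_{G,F}$ is the polytopal complex of bounded cells of the common refinement of these decompositions for $b=0,\dots,k_0$. The vertex $\mathbf{x}(\delta)$ is the one corresponding to $C_\delta$: the unique point such that for every $b$ all routes of $C_\delta$ starting with $e_{0,b}$ attain the minimum in $T^{\mathrm h}_b$. *)

(* Defs.v *)
From HB Require Import structures.
From mathcomp Require Import all_boot all_order all_algebra.
From mathcomp Require Import boolp classical_sets functions reals.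

Set Implicit Arguments.
Unset Strict Implicit.
Unset Printing Implicit Defensive.

Import Order.TTheory GRing.Theory Num.Theory.

Local Open Scope classical_set_scope.
Local Open Scope ring_scope.

(** * The multioruga graph oru(k_0, ..., k_n) *)

Section Multioruga.
Variables (n : nat) (K : 'I_n.+1 -> nat).

Definition oru_vertex := 'I_n.+2.

(* The element b over i is e_{i,b}: for each i, the edges from v_i to v_{i+1}
   are numbered from bottom to top. *)
Definition oru_edge := {i : 'I_n.+1 & 'I_(K i).+1}.

Definition edge_tail (e : oru_edge) : oru_vertex := inord (tag e).
Definition edge_head (e : oru_edge) : oru_vertex := inord (tag e).+1.

Fixpoint dipath (u : oru_vertex) (s : seq oru_edge) (v : oru_vertex) : bool :=
  if s is e :: s' then (edge_tail e == u) && dipath (edge_head e) s' v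
  else u == v.

(* The route [e_{0,b_0}, ..., e_{n,b_n}] is represented by (b_0, ..., b_n);
   lemmas [dipath_route] and [route_edges_inj] below show that these are the
   directed paths from v_0 to v_{n+1}. *)
Definition route := {dffun forall i : 'I_n.+1, 'I_(K i).+1}.

Definition route_edges (r : route) : seq oru_edge :=
  [seq Tagged (fun i => 'I_(K i).+1) (r i) | i <- enum 'I_n.+1].

Definition weakly_below (r s : route) : bool := [forall i, (r i <= s i)%N].

Definition route_count (r : route) : nat := #|[pred s | weakly_below s r]|.

Definition bottom_route : route := [ffun i : 'I_n.+1 => ord0 : 'I_(K i).+1].

(* Replaces the edge e_{l,s} of r by e_{l,s+1}; only meaningful for s < k_l. *)
Definition raise (r : route) (l : 'I_n.+1) : route :=
  [ffun i : 'I_n.+1 => if i == l then inord (r i).+1 else r i].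

(** * Multipermutations *)

Definition multiperm (d : seq 'I_n.+1) : Prop :=
  forall i, count_mem i d = K i.

Definition multiperm_clique (d : seq 'I_n.+1) : seq route :=
  bottom_route :: scanl raise bottom_route d.

(* Shortest prefix of d with p letters i, i.e. d up to its p-th letter i. *)
Fixpoint upto (i : 'I_n.+1) (p : nat) (d : seq 'I_n.+1) : seq 'I_n.+1 :=
  if p is p'.+1 then
    if d is l :: d' then l :: upto i (if l == i then p' else p) d' else [::]
  else [::].

Definition letters_upto (d : seq 'I_n.+1) (i : 'I_n.+1) (p : nat)
  (k : 'I_n.+1) : nat := count_mem k (upto i p d).

(** * The tropical framingtope *)

(* The set I = {(i,j) : 1 <= i <= n, 1 <= j <= k_i}.  Ordinals start at 0, so
   (i,j) is stored as (i-1,j-1); [coord_row] and [coord_col] recover i and j. *)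
Definition coord_index := {i : 'I_n & 'I_(K (lift ord0 i))}.
Definition coord_row (q : coord_index) : 'I_n.+1 := lift ord0 (tag q).
Definition coord_col (q : coord_index) : nat := (tagged q).+1.

Variable R : realType.

Definition coord_space := {ffun coord_index -> R}.

(* x_{i+1,b}; the value 0 at b = 0 is never used. *)
Definition trop_coord (x : coord_space) (i : 'I_n)
  (b : 'I_(K (lift ord0 i)).+1) : R :=
  if unlift ord0 b is Some j
  then x (Tagged (fun i => 'I_(K (lift ord0 i))) j) else 0.

Definition trop_term (h : route -> R) (x : coord_space) (r : route) : R :=
  - h r + \sum_(i < n | r (lift ord0 i) != ord0) trop_coord x (r (lift ord0 i)).

(* The route [e_{0,b}, e_{1,0}, ..., e_{n,0}]: its term serves as the initial
   value of the minimum over all routes starting with e_{0,b}. *)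
Definition base_route (b : 'I_(K ord0).+1) : route :=
  [ffun i : 'I_n.+1 => dfwith (fun i => ord0 : 'I_(K i).+1) b i].

Definition trop_min (h : route -> R) (b : 'I_(K ord0).+1)
  (x : coord_space) : R :=
  \big[Num.min/trop_term h x (base_route b)]_(r : route | r ord0 == b)
    trop_term h x r.

Definition attains (h : route -> R) (x : coord_space) (r : route) : Prop :=
  trop_term h x r = trop_min h (r ord0) x.

(* The (closed) cells of the decomposition of R^I induced by T_b. *)
Definition tropical_cells (h : route -> R) (b : 'I_(K ord0).+1) :
  set (set coord_space) :=
  [set C | exists S : {set route},
     [/\ exists r, r \in S,
         forall r, r \in S -> r ord0 = b,
         C = [set x | forall r, r \in S -> attains h x r]
       & C !=set0]].

Definition common_refinement (J : Type) (D : J -> set (set coord_space)) :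
  set (set coord_space) :=
  [set C | C !=set0 /\
     exists2 E : J -> set coord_space, forall b, D b (E b) & C = \bigcap_b E b].

Definition bounded_cell (C : set coord_space) : Prop :=
  exists M : R, forall x, C x -> forall q, `|x q| <= M.

Definition framingtope (h : route -> R) : set (set coord_space) :=
  [set C | common_refinement (tropical_cells h) C /\ bounded_cell C].

Definition framingtope_vertices (h : route -> R) : set coord_space :=
  [set x | framingtope h [set x]].

Definition corresponds_to_clique (h : route -> R) (d : seq 'I_n.+1)
  (x : coord_space) : Prop :=
  forall r, r \in multiperm_clique d -> attains h x r.

Definition route_height (r : route) : R := (route_count r)%:R.

Definition multiperm_point (d : seq 'I_n.+1) : coord_space :=
  [ffun q => \sum_(1 <= p < (coord_col q).+1)
               \prod_(k < n.+1 | k != coord_row q)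
                 (letters_upto d (coord_row q) p k).+1%:R].

End Multioruga.

Arguments route_height {n} K R r.
Arguments multiperm_point {n} K R d.

Lemma route_edges_inj n (K : 'I_n.+1 -> nat) : injective (@route_edges n K).
Proof.
move=> r s /eq_in_map rs; apply/ffunP => i.
have /eqP := rs i (mem_enum _ i).
by rewrite eq_Tagged => /eqP.
Qed.

Lemma dipath_route n (K : 'I_n.+1 -> nat) (s : seq (oru_edge K)) :
  dipath ord0 s ord_max <-> exists r : route K, s = route_edges r.
Proof.
have dip (t : seq (oru_edge K)) (u : 'I_n.+2) :
    dipath u t ord_max <->
    [seq nat_of_ord (tag e) | e <- t] = iota u (n.+1 - u).
  elim: t u => [|e t IH] u /=.
    split=> [/eqP ->|]; first by rewrite /= subnn.
    move/(congr1 size); rewrite /= size_iota => /esym/eqP; rewrite subn_eq0 => h.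
    by apply/eqP/val_inj/eqP; rewrite eqn_leq h /= -ltnS ltn_ord.
  have hi := ltn_ord (tag e).
  have tE : edge_tail e = tag e :> nat by rewrite /edge_tail inordK // ltnW.
  have hE : edge_head e = (tag e).+1 :> nat by rewrite /edge_head inordK.
  rewrite -val_eqE /= tE; split.
    by move=> /andP[/eqP eu] /IH ->; rewrite hE -eu (subSn (hi : (tag e <= n)%N)).
  case E: (n.+1 - u)%N => [|m] //= [eu te]; rewrite eu eqxx /=.
  by apply/IH; rewrite te hE eu subnS E.
rewrite dip (_ : iota _ _ = iota 0 n.+1) // -val_enum_ord; split; last first.
  by case=> r ->; rewrite /route_edges -map_comp.
rewrite (map_comp val (@tag _ _)) => /(inj_map val_inj) st.
have ext i : exists b : 'I_(K i).+1, Tagged (fun i => 'I_(K i).+1) b \in s.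
  have : i \in [seq tag e | e <- s] by rewrite st mem_enum.
  by case/mapP=> -[j b] /= bs ->; exists b.
exists [ffun i : 'I_n.+1 => xchoose (ext i)].
have us : uniq [seq tag e | e <- s] by rewrite st enum_uniq.
rewrite /route_edges -st -map_comp -[LHS]map_id; apply/eq_in_map => -[i b] bs /=.
rewrite ffunE.
have cs := xchooseP (ext i); set c := xchoose _ in cs *.
have tag_inj : {in s &, injective (@tag _ (fun i => 'I_(K i).+1))}.
  elim: (s) us => //= e t IH /andP[et ut] x y; rewrite !inE.
  move=> /predU1P[->|xt] /predU1P[->|yt] // xy; last exact: IH.
    by rewrite xy map_f in et.
  by rewrite -xy map_f in et.
by rewrite -(tag_inj _ _ bs cs erefl).
Qed.

(* Main.v *)
Require Import Defs.
From mathcomp Require Import all_boot all_order all_algebra.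
From mathcomp Require Import boolp classical_sets functions reals.

(** Write a route as r = (b_0, ..., b_n); then h(r) is the product of the
    numbers b_i + 1 ([route_count_prod]).  The term of r at x is -h(r) plus the
    sum over i >= 1 of x_{i,b_i}, with x_{i,0} = 0: apart from h it is a sum of
    functions of the separate coordinates.

    Two consecutive routes of the clique C_d differ by raising one edge of some
    v_l, and if both attain their minima and l >= 1, then their terms are
    equal; so the increment x_{l,s+1} - x_{l,s} is determined.  Every increment
    occurs in C_d, hence at most one point corresponds to C_d
    ([clique_point_unique]).  At the point of the statement the increment is
    the product over k <> l of a_k + 1, where a_k counts the letters k read so
    far; this is exactly the growth of h along that step of C_d.

    To see that the routes of C_d do attain the minima at this point, define
    x_{0,j} by the same formula and compare h(r), for an arbitrary route r,
    with 1 + sum_{i >= 0} x_{i,b_i}.  Cut r down to its meet with the running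
    route of C_d.  When the running route is raised at l, the cut either stays
    put or is raised at l too, and then h of it grows by the product over
    k <> l of factors min(b_k, a_k) + 1, which is at most the increment
    of x_{l,_}.  Summing, h(r) <= 1 + sum x_{i,b_i}, with equality if r is in
    C_d ([prod_le_coord_height]).  For a fixed b_0 this says that the routes of
    C_d starting with b_0 have the least term.

    It remains to identify the vertices.  The function h is strictly
    supermodular: the routes below r or below s lie below the join of r and s,
    and the join itself is below neither when r and s are incomparable
    ([route_count_supermodular]).  The rest of the term is modular in r, so the
    routes that attain their minima at one point x are pairwise comparable
    ([attains_comparable]).  Two cliques with the same point are then
    comparable element by element, which forces the words to be equal
    ([multiperm_clique_inj]).  Conversely, if {x} is a cell, cut out by
    requiring that certain routes attain, these routes form a chain, the chain
    extends to some C_d ([chain_sub_clique]), and the point of C_d then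
    satisfies all the conditions that cut out {x}, so it is x. *)

Set Implicit Arguments.
Unset Strict Implicit.
Unset Printing Implicit Defensive.

Import Order.TTheory GRing.Theory Num.Theory.

(** * Counting letters in prefixes of words *)

Lemma count_mem_rcons (T : eqType) (k l : T) (u : seq T) :
  count_mem k (rcons u l) = (count_mem k u + (l == k))%N.
Proof. by rewrite -cats1 count_cat /= addn0. Qed.

Lemma size_sum_count (T : finType) (u : seq T) :
  size u = (\sum_i count_mem i u)%N.
Proof.
elim: u => [|l u IH] /=; first by rewrite big1.
rewrite big_split /= -IH (bigD1 l) //= eqxx big1 ?addn0 // => i.
by rewrite eq_sym => /negbTE ->.
Qed.

Lemma split_at_letter (T : eqType) (i : T) (d : seq T) j :
  (j < count_mem i d)%N ->
  exists u v, d = u ++ i :: v /\ count_mem i u = j.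
Proof.
elim: d j => // l d IH j /=; case: (eqVneq l i) => [->|ne] /=; last first.
  rewrite add0n => /IH[u [v [-> cu]]].
  by exists (l :: u), v; rewrite /= (negbTE ne).
case: j => [_|j]; first by exists [::], d.
rewrite add1n ltnS => /IH[u [v [-> cu]]].
by exists (i :: u), v; rewrite /= eqxx cu.
Qed.

Lemma split_at_count (T : eqType) (i : T) (d : seq T) j :
  (j <= count_mem i d)%N -> exists u v, d = u ++ v /\ count_mem i u = j.
Proof.
rewrite leq_eqVlt => /predU1P[->|/split_at_letter[u [v [-> cu]]]].
  by exists d, [::]; rewrite cats0.
by exists u, (i :: v).
Qed.

Lemma mem_scanl (S : eqType) (T : Type) (f : S -> T -> S) x0 (d : seq T) x :
  x \in x0 :: scanl f x0 d <-> exists u v, d = u ++ v /\ x = foldl f x0 u.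
Proof.
elim: d x0 x => [|l d IH] x0 x /=.
  rewrite inE; split=> [/eqP ->|[[|? ?] [v [// e ->]]]]; last exact: eqxx.
  by exists [::], [::].
rewrite in_cons; split.
  case/predU1P => [->|/IH[u [v [-> ->]]]]; first by exists [::], (l :: d).
  by exists (l :: u), v.
case=> [[|l' u] [v [/= e ->]]]; first by rewrite eqxx.
by case: e => -> ed; apply/orP; right; apply/IH; exists u, v.
Qed.

(** * The coordinates read off a word *)

Definition coord_step n (d : seq 'I_n.+1) i p : nat :=
  \prod_(k < n.+1 | k != i) (letters_upto d i p k).+1.

(** The number x_{i,j} of the statement.  The row i = 0 is allowed as well,
    which makes the estimate below symmetric in all letters. *)
Definition coord_height n (d : seq 'I_n.+1) i j : nat :=
  \sum_(1 <= p < j.+1) coord_step d i p.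

Lemma upto_cat n i p (u v : seq 'I_n.+1) :
  (p <= count_mem i u)%N -> upto i p (u ++ v) = upto i p u.
Proof.
elim: u p => [|l u IH] [|p] //=; first by case: v.
case: eqP => [-> | ne] /=; first by rewrite add1n ltnS => /IH ->.
by rewrite add0n => /IH ->.
Qed.

Lemma upto_last n i (u : seq 'I_n.+1) :
  upto i (count_mem i u).+1 (rcons u i) = rcons u i.
Proof.
elim: u => [|l u IH] /=; first by rewrite eqxx.
by case: eqP => /= ne; rewrite ?add1n ?add0n IH.
Qed.

Lemma coord_height0 n (d : seq 'I_n.+1) i : coord_height d i 0 = 0%N.
Proof. by rewrite /coord_height big_geq. Qed.

Lemma coord_height_cat n (u v : seq 'I_n.+1) i j :
  (j <= count_mem i u)%N -> coord_height (u ++ v) i j = coord_height u i j.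
Proof.
move=> ju; apply: eq_big_nat => p /andP[_ pj].
apply: eq_bigr => k _; rewrite /letters_upto upto_cat //.
by apply: leq_trans ju; rewrite -ltnS.
Qed.

(** Reading one more letter l adds to row l an entry that involves all the
    letters read so far: the word up to its last letter is the whole word. *)
Lemma coord_height_rcons n (u : seq 'I_n.+1) l :
  coord_height (rcons u l) l (count_mem l u).+1 =
  (coord_height u l (count_mem l u)
   + \prod_(k < n.+1 | k != l) (count_mem k u).+1)%N.
Proof.
rewrite {1}/coord_height big_nat_recr //=; congr addn.
  by rewrite -cats1; apply: coord_height_cat.
rewrite /coord_step; apply: eq_bigr => k kl; rewrite /letters_upto upto_last.
by rewrite count_mem_rcons eq_sym (negbTE kl) addn0.
Qed.

(** The coordinates of the meet of the route f with the route reached after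
    reading u. *)
Definition truncate n (f : 'I_n.+1 -> nat) (u : seq 'I_n.+1) i : nat :=
  minn (f i) (count_mem i u).

(** Both sides are followed while u is read letter by letter.  A letter l
    either leaves the truncation unchanged or raises its coordinate l by one.
    In the second case the product gains the factors at k <> l, each at most
    count_mem k u + 1, and the sum gains the product of these upper bounds.
    If f dominates u, then every step is of the second kind and the bounds are
    attained. *)
Lemma prod_le_coord_height n (f : 'I_n.+1 -> nat) (u : seq 'I_n.+1) :
  (\prod_i (truncate f u i).+1
     <= 1 + \sum_i coord_height u i (truncate f u i))%N /\
  ((forall i, (count_mem i u <= f i)%N) ->
   \prod_i (truncate f u i).+1
     = 1 + \sum_i coord_height u i (truncate f u i))%N.
Proof.
elim/last_ind: u => [|u l [IHle IHeq]].
  have m0 i : truncate f [::] i = 0%N by rewrite /truncate minn0.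
  have -> : (\prod_i (truncate f [::] i).+1 = 1)%N.
    by apply: big1 => i _; rewrite m0.
  have -> // : (\sum_i coord_height [::] i (truncate f [::] i) = 0)%N.
  by apply: big1 => i _; rewrite m0 coord_height0.
have mE i : i != l -> truncate f (rcons u l) i = truncate f u i.
  by move=> il; rewrite /truncate count_mem_rcons eq_sym (negbTE il) addn0.
have hE i : coord_height (rcons u l) i (truncate f u i)
            = coord_height u i (truncate f u i).
  by rewrite -cats1 coord_height_cat // geq_minr.
have weak : (forall i, (count_mem i (rcons u l) <= f i)%N) ->
    forall i, (count_mem i u <= f i)%N.
  by move=> le i; apply: leq_trans (le i); rewrite count_mem_rcons leq_addr.
have [fl|fl] := leqP (f l) (count_mem l u).
  have m'm i : truncate f (rcons u l) i = truncate f u i.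
    case: (eqVneq i l) => [->|/mE //].
    rewrite /truncate count_mem_rcons eqxx addn1.
    by rewrite (minn_idPl fl) (minn_idPl (leqW fl)).
  have -> : (\prod_i (truncate f (rcons u l) i).+1
             = \prod_i (truncate f u i).+1)%N.
    by apply: eq_bigr => i _; rewrite m'm.
  have -> : (\sum_i coord_height (rcons u l) i (truncate f (rcons u l) i)
             = \sum_i coord_height u i (truncate f u i))%N.
    by apply: eq_bigr => i _; rewrite m'm hE.
  by split=> // /weak.
have ml : truncate f u l = count_mem l u by apply/minn_idPr/ltnW.
have ml' : truncate f (rcons u l) l = (count_mem l u).+1.
  by rewrite /truncate count_mem_rcons eqxx addn1; apply/minn_idPr.
have -> : (\prod_i (truncate f (rcons u l) i).+1 =
    \prod_i (truncate f u i).+1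
    + \prod_(i < n.+1 | i != l) (truncate f u i).+1)%N.
  rewrite (bigD1 l) //= [in X in _ = (X + _)%N](bigD1 l) //= ml ml'.
  rewrite [in RHS]addnC -mulSn; congr muln.
  by apply: eq_bigr => i /mE ->.
have -> : (\sum_i coord_height (rcons u l) i (truncate f (rcons u l) i) =
    \sum_i coord_height u i (truncate f u i)
    + \prod_(k < n.+1 | k != l) (count_mem k u).+1)%N.
  rewrite (bigD1 l) //= [in X in _ = (X + _)%N](bigD1 l) //= ml'.
  rewrite coord_height_rcons ml addnAC; congr (_ + _ + _)%N.
  by apply: eq_bigr => i il; rewrite mE.
split.
  by rewrite addnA leq_add // leq_prod // => i _; rewrite ltnS geq_minr.
move=> /weak le; rewrite addnA IHeq //; congr addn; apply: eq_bigr => i _.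
by rewrite /truncate (minn_idPr (le i)).
Qed.

(** * The lattice of routes and supermodularity of the route count *)

Definition comparable_routes n (K : 'I_n.+1 -> nat) (r s : route K) : bool :=
  weakly_below r s || weakly_below s r.

Definition join_route n (K : 'I_n.+1 -> nat) (r s : route K) : route K :=
  [ffun i : 'I_n.+1 => if (r i <= s i)%N then s i else r i].

Definition meet_route n (K : 'I_n.+1 -> nat) (r s : route K) : route K :=
  [ffun i : 'I_n.+1 => if (r i <= s i)%N then r i else s i].

Definition down_set n (K : 'I_n.+1 -> nat) (r : route K) : {set route K} :=
  [set s | weakly_below s r]%SET.

Lemma weakly_below_refl n (K : 'I_n.+1 -> nat) (r : route K) : weakly_below r r.
Proof. by apply/forallP => i. Qed.

Lemma weakly_below_trans n (K : 'I_n.+1 -> nat) (r s t : route K) :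
  weakly_below r s -> weakly_below s t -> weakly_below r t.
Proof.
move=> /forallP rs /forallP st; apply/forallP => i.
exact: leq_trans (rs i) (st i).
Qed.

Lemma weakly_below_anti n (K : 'I_n.+1 -> nat) (r s : route K) :
  weakly_below r s -> weakly_below s r -> r = s.
Proof.
move=> /forallP rs /forallP sr; apply/ffunP => i.
by apply/val_inj/eqP; rewrite eqn_leq rs sr.
Qed.

Lemma route_countE n (K : 'I_n.+1 -> nat) (r : route K) :
  route_count r = #|down_set r|.
Proof. by apply: eq_card => s; rewrite [RHS]inE. Qed.

Lemma card_ord_le m (b : 'I_m.+1) : #|[pred s : 'I_m.+1 | (s <= b)%N]| = b.+1.
Proof.
rewrite -sum1_card (eq_bigl (fun s : 'I_m.+1 => (s < b.+1)%N)) //.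
by rewrite big_ord_narrow ?ltn_ord // sum1_card card_ord.
Qed.

Lemma route_count_prod n (K : 'I_n.+1 -> nat) (r : route K) :
  route_count r = (\prod_i (r i).+1)%N.
Proof.
pose F (i : 'I_n.+1) := [pred s : 'I_(K i).+1 | (s <= r i)%N].
have -> : route_count r = #|(family F : simpl_pred (route K))|.
  by apply: eq_card => s; apply/forallP/familyP => h i; have := h i.
rewrite card_family foldrE big_map big_enum /=.
by apply: eq_bigr => i _; rewrite card_ord_le.
Qed.

(** The route count is strictly monotone, because the set of routes below r
    determines r; it therefore serves as a rank function. *)
Lemma eq_of_below_of_count_le n (K : 'I_n.+1 -> nat) (r s : route K) :
  weakly_below r s -> (route_count s <= route_count r)%N -> r = s.
Proof.
move=> rs; rewrite !route_countE => le.
have sub : down_set r \subset down_set s.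
  by apply/fintype.subsetP => t; rewrite !inE => /weakly_below_trans; apply.
have /eqP E : down_set r == down_set s by rewrite eqEcard sub.
apply: (weakly_below_anti rs).
have : s \in down_set r by rewrite E inE weakly_below_refl.
by rewrite inE.
Qed.

(** By inclusion-exclusion the left side counts the union and the intersection
    of the two down-sets.  The intersection is the down-set of the meet; the
    union is contained in the down-set of the join, and misses the join. *)
Lemma route_count_supermodular n (K : 'I_n.+1 -> nat) (r s : route K) :
  ~~ comparable_routes r s ->
  (route_count r + route_count s
     < route_count (join_route r s) + route_count (meet_route r s))%N.
Proof.
rewrite negb_or => /andP[nrs nsr]; rewrite !route_countE -cardsUI.
have -> : down_set r :&: down_set s = down_set (meet_route r s).
  apply/setP => t; rewrite !inE.
  apply/andP/forallP => [[/forallP a /forallP b] i|a].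
    by rewrite ffunE; case: ifP.
  by split; apply/forallP => i; have := a i; rewrite ffunE;
    case: (leqP (r i) (s i)) => // h1 h2; apply: leq_trans h2 _ => //;
    apply: ltnW.
rewrite ltn_add2r; apply: proper_card; apply/properP; split.
  apply/fintype.subsetP => t; rewrite !inE => /orP[] /forallP a;
    apply/forallP => i; rewrite ffunE; case: (leqP (r i) (s i)) => // h;
    apply: leq_trans (a i) _ => //; exact: ltnW.
exists (join_route r s); rewrite !inE ?weakly_below_refl //.
apply/norP; split.
  apply: contra nsr => /forallP a; apply/forallP => i; have := a i.
  by rewrite ffunE; case: (leqP (r i) (s i)) => // /ltnW.
apply: contra nrs => /forallP a; apply/forallP => i; have := a i.
by rewrite ffunE; case: (leqP (r i) (s i)) => // lt le; rewrite ltnNge le in lt.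
Qed.

(** * Cliques of multipermutations *)

Lemma foldl_raise n (K : 'I_n.+1 -> nat) (u : seq 'I_n.+1) :
  (forall i, count_mem i u <= K i)%N ->
  forall i, foldl (@raise n K) (bottom_route K) u i = count_mem i u :> nat.
Proof.
elim/last_ind: u => [|u l IH] uK i; first by rewrite ffunE.
have uK' j : (count_mem j u <= K j)%N.
  by apply: leq_trans (uK j); rewrite count_mem_rcons leq_addr.
rewrite foldl_rcons ffunE count_mem_rcons; case: (eqVneq i l) => [->|_].
  rewrite inordK ?IH // ?addn1 //.
  by have := uK l; rewrite count_mem_rcons eqxx addn1.
by rewrite addn0 IH.
Qed.

Lemma mem_multiperm_clique n (K : 'I_n.+1 -> nat) (d : seq 'I_n.+1)
    (r : route K) : multiperm K d ->
  r \in multiperm_clique K d <->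
  exists u v, d = u ++ v /\ forall i, r i = count_mem i u :> nat.
Proof.
move=> dK; rewrite mem_scanl.
have cat_le u v : d = u ++ v -> forall i, (count_mem i u <= K i)%N.
  by move=> dE i; rewrite -dK dE count_cat leq_addr.
split=> -[u [v [dE rE]]]; exists u, v; split=> //.
  by move=> i; rewrite rE; apply/foldl_raise/cat_le/dE.
apply/ffunP => i; apply/val_inj; rewrite /= rE foldl_raise //.
exact/cat_le/dE.
Qed.

Lemma prefix_route n (K : 'I_n.+1 -> nat) (u v : seq 'I_n.+1) :
  multiperm K (u ++ v) ->
  exists2 r : route K, r \in multiperm_clique K (u ++ v) &
                       forall i, r i = count_mem i u :> nat.
Proof.
move=> dK; have uK i : (count_mem i u <= K i)%N.
  by rewrite -dK count_cat leq_addr.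
exists (foldl (@raise n K) (bottom_route K) u); last exact: foldl_raise.
apply/mem_multiperm_clique => //; exists u, v; split=> //.
exact: foldl_raise.
Qed.

(** After a common prefix u, different next letters l and l' would lead to two
    routes, each above the other at one of the places l and l'. *)
Lemma multiperm_clique_inj n (K : 'I_n.+1 -> nat) (d d' : seq 'I_n.+1) :
  multiperm K d -> multiperm K d' ->
  (forall r s, r \in multiperm_clique K d -> s \in multiperm_clique K d' ->
     comparable_routes r s) ->
  d = d'.
Proof.
suff main v v' u : multiperm K (u ++ v) -> multiperm K (u ++ v') ->
    (forall r s, r \in multiperm_clique K (u ++ v) ->
       s \in multiperm_clique K (u ++ v') -> comparable_routes r s) ->
    v = v'.
  exact: (main d d' [::]).
elim: v v' u => [|l w IH] [|l' w'] u // dK dK' cmp.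
- by have := dK' l'; rewrite -dK !count_cat /= eqxx => /addnI.
- by have := dK l; rewrite -dK' !count_cat /= eqxx => /addnI.
rewrite -!cat_rcons in dK dK' cmp.
have ll' : l = l'.
  have [r rC rE] := prefix_route dK; have [s sC sE] := prefix_route dK'.
  apply/eqP; case/orP: (cmp _ _ rC sC) => /forallP le.
    have := le l; rewrite rE sE !count_mem_rcons eqxx leq_add2l eq_sym.
    by case: eqP.
  by have := le l'; rewrite rE sE !count_mem_rcons eqxx leq_add2l; case: eqP.
by rewrite -ll' in dK' cmp *; rewrite (IH _ _ dK dK' cmp).
Qed.

(** The word is built letter by letter, keeping the invariant that each route
    of A has either been visited already or lies above the current route.  The
    next letter steps towards the smallest route of A strictly above the
    current one; all other routes of A above the current one lie above that
    one, hence above the new route. *)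
Lemma chain_sub_clique n (K : 'I_n.+1 -> nat) (A : {set route K}) :
  (forall r s, r \in A -> s \in A -> comparable_routes r s) ->
  exists2 d, multiperm K d & forall r, r \in A -> r \in multiperm_clique K d.
Proof.
move=> chainA.
pose P u := (forall i, count_mem i u <= K i)%N /\ forall a : route K, a \in A ->
  (exists w v, u = w ++ v /\ forall i, a i = count_mem i w :> nat) \/
  (forall i, count_mem i u <= a i)%N.
have [d [dK dA] sd] : exists2 d, P d & size d = (\sum_i K i)%N.
  suff ext t : (t <= \sum_i K i)%N -> exists2 u, P u & size u = t by exact: ext.
  elim: t => [_|t IH ht]; first by exists [::] => //; split=> // a _; right.
  have [u [uK uA] su] := IH (ltnW ht).
  suff [l lK lA] : exists2 l, (count_mem l u < K l)%N & forall a : route K,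
      a \in A -> (forall i, count_mem i u <= a i)%N ->
      (forall i, a i = count_mem i u :> nat) \/ (count_mem l u < a l)%N.
    exists (rcons u l); last by rewrite size_rcons su.
    split=> [i|a aA].
      by rewrite count_mem_rcons; case: eqP => [<-|_]; rewrite ?addn1 ?addn0.
    have [[w [v [uE aE]]]|ua] := uA a aA.
      by left; exists w, (rcons v l); rewrite uE rcons_cat.
    have [aE|la] := lA a aA ua; first by left; exists u, [:: l]; rewrite cats1.
    right=> i; rewrite count_mem_rcons.
    by case: eqP => [<-|_]; rewrite ?addn1 ?addn0.
  pose above := [pred a : route K | (a \in A) &&
    [forall i, (count_mem i u <= a i)%N] &&
    [exists i, (count_mem i u < a i)%N]].
  have [a1 a1P|none] := pickP above.
    (* On a chain the minimum of the rank function is the least element. *)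
    case: (arg_minnP (@route_count n K) a1P) => a0 /andP[/andP[a0A _]].
    case/existsP=> l la0 min.
    exists l => [|a aA ua]; first by rewrite (leq_trans la0) // -ltnS ltn_ord.
    case: (pickP (fun i => (count_mem i u < a i)%N)) => [j ja|eqa]; last first.
      by left=> i; apply/eqP; rewrite eqn_leq ua leqNgt eqa.
    right; have aP : above a.
      rewrite /= aA /=; apply/andP.
      by split; [apply/forallP|apply/existsP; exists j].
    have a0a : weakly_below a0 a.
      case/orP: (chainA _ _ a0A aA) => // aa0.
      by rewrite (eq_of_below_of_count_le aa0 (min a aP)) weakly_below_refl.
    by apply: leq_trans la0 _; have /forallP := a0a.
  case: (pickP (fun i => (count_mem i u < K i)%N)) => [l lK|full]; last first.
    suff : (\sum_i K i <= t)%N by rewrite leqNgt ht.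
    by rewrite -su size_sum_count leq_sum // => i _; rewrite leqNgt full.
  exists l => // a aA ua; left=> i; apply/eqP; rewrite eqn_leq ua andbT leqNgt.
  apply/negP => ia; have := none a; rewrite /= aA /=.
  by move=> /negP[]; apply/andP; split; [apply/forallP|apply/existsP; exists i].
(* Each letter i occurs at most K i times, and the total is the sum of the
   K i, so no inequality is strict. *)
have dM : multiperm K d.
  have /leqif_sum [_] : forall i : 'I_n.+1, true ->
      (count_mem i d <= K i ?= iff (count_mem i d == K i))%N.
    by move=> i _; split.
  rewrite -size_sum_count sd eqxx => /esym/forallP h i.
  exact/eqP/h.
exists d => // a aA; apply/mem_multiperm_clique => //.
have [//|ge] := dA a aA; exists d, [::]; rewrite cats0; split=> // i.
by apply/eqP; rewrite eqn_leq ge andbT dM -ltnS ltn_ord.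
Qed.

Lemma route_count_le_coord_height n (K : 'I_n.+1 -> nat) (d : seq 'I_n.+1)
    (r : route K) : multiperm K d ->
  (route_count r <= 1 + \sum_i coord_height d i (r i))%N.
Proof.
move=> dK; have [le _] := prod_le_coord_height (fun i => r i : nat) d.
have tE i : truncate (fun i => r i : nat) d i = r i.
  by apply/minn_idPl; rewrite dK -ltnS ltn_ord.
rewrite route_count_prod; under eq_bigr => i _ do rewrite -tE.
by under [X in (_ <= _ + X)%N]eq_bigr => i _ do rewrite -tE.
Qed.

Lemma route_count_clique n (K : 'I_n.+1 -> nat) (d : seq 'I_n.+1)
    (r : route K) : multiperm K d -> r \in multiperm_clique K d ->
  route_count r = (1 + \sum_i coord_height d i (r i))%N.
Proof.
move=> dK /(mem_multiperm_clique _ dK)[u [v [dE rE]]].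
have [_ eq] := prod_le_coord_height (fun i => r i : nat) u.
have tE i : truncate (fun i => r i : nat) u i = r i.
  by rewrite /truncate rE minnn.
rewrite route_count_prod; under eq_bigr => i _ do rewrite -tE.
rewrite eq => [|i]; last by rewrite rE.
by congr addn; apply: eq_bigr => i _; rewrite tE dE coord_height_cat ?rE.
Qed.

(** * Attaining the tropical minima *)

Local Open Scope ring_scope.

Lemma trop_coord0 (R : realType) n (K : 'I_n.+1 -> nat)
    (x : coord_space K R) i :
  trop_coord x (ord0 : 'I_(K (lift ord0 i)).+1) = 0.
Proof. by rewrite /trop_coord unlift_none. Qed.

Lemma trop_termE (R : realType) n (K : 'I_n.+1 -> nat) (h : route K -> R)
    (x : coord_space K R) (r : route K) :
  trop_term h x r = - h r + \sum_(i < n) trop_coord x (r (lift ord0 i)).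
Proof.
rewrite /trop_term big_mkcond; congr (_ + _); apply: eq_bigr => i _.
by case: eqP => [->|//]; rewrite trop_coord0.
Qed.

Lemma trop_termB (R : realType) n (K : 'I_n.+1 -> nat) (h : route K -> R)
    (x y : coord_space K R) (r : route K) :
  trop_term h x r - trop_term h y r =
  \sum_(i < n) (trop_coord x (r (lift ord0 i))
                - trop_coord y (r (lift ord0 i))).
Proof. by rewrite !trop_termE sumrB opprD addrACA subrr add0r. Qed.

Lemma attainsP (R : realType) n (K : 'I_n.+1 -> nat) (h : route K -> R)
    (x : coord_space K R) (r : route K) :
  attains h x r <->
  forall s : route K, s ord0 = r ord0 -> trop_term h x r <= trop_term h x s.
Proof.
rewrite /attains; split=> [-> s /eqP s0|min]; first exact: bigmin_le_cond.
apply/le_anti; rewrite bigmin_le_cond // andbT; apply/bigmin_geP; split.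
  by apply: min; rewrite ffunE dfwith_in.
by move=> s /eqP /min.
Qed.

(** The join and the meet of r and s start with the same two edges as r and s,
    so their terms are bounded below by the same two minima, while the
    coordinate parts of the four terms cancel. *)
Lemma attains_supermodular (R : realType) n (K : 'I_n.+1 -> nat)
    (h : route K -> R) (x : coord_space K R) (r s : route K) :
  attains h x r -> attains h x s ->
  h (join_route r s) + h (meet_route r s) <= h r + h s.
Proof.
move=> /attainsP ar /attainsP as_.
have sum_le : trop_term h x r + trop_term h x s <=
    trop_term h x (join_route r s) + trop_term h x (meet_route r s).
  case: (leqP (r ord0) (s ord0)) => rs0.
    by rewrite addrC lerD // ?as_ ?ar // ffunE rs0.
  by rewrite lerD // ?as_ ?ar // ffunE leqNgt rs0.
have modular : \sum_(i < n) trop_coord x (r (lift ord0 i)) +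
    \sum_(i < n) trop_coord x (s (lift ord0 i)) =
    \sum_(i < n) trop_coord x (join_route r s (lift ord0 i)) +
    \sum_(i < n) trop_coord x (meet_route r s (lift ord0 i)).
  rewrite -!big_split /=; apply: eq_bigr => i _; rewrite !ffunE.
  by case: ifP => _ //; rewrite addrC.
move: sum_le; rewrite !trop_termE (addrACA (- h r)).
rewrite (addrACA (- h (join_route r s))) -modular lerD2r.
by rewrite -!opprD lerN2.
Qed.

Lemma attains_comparable (R : realType) n (K : 'I_n.+1 -> nat)
    (x : coord_space K R) (r s : route K) :
  attains (route_height K R) x r -> attains (route_height K R) x s ->
  comparable_routes r s.
Proof.
move=> ar as_; have := attains_supermodular ar as_.
rewrite /route_height -!natrD ler_nat; apply: contraTT.
by move=> /route_count_supermodular; rewrite ltnNge.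
Qed.

Lemma trop_coord_point (R : realType) n (K : 'I_n.+1 -> nat)
    (d : seq 'I_n.+1) i (b : 'I_(K (lift ord0 i)).+1) :
  trop_coord (multiperm_point K R d) b = (coord_height d (lift ord0 i) b)%:R.
Proof.
rewrite /trop_coord; case: unliftP => [j ->|->]; last by rewrite coord_height0.
rewrite ffunE natr_sum lift0; apply: eq_bigr => p _; rewrite natr_prod.
by apply: eq_bigr.
Qed.

(** Adding the row 0 of coordinates to both sides shows that, on routes with a
    fixed first edge, the term is up to a constant the gap between the sum of
    the coordinates and the route count. *)
Lemma trop_term_point (R : realType) n (K : 'I_n.+1 -> nat)
    (d : seq 'I_n.+1) (r : route K) :
  trop_term (route_height K R) (multiperm_point K R d) r =
  (\sum_i coord_height d i (r i))%:R - (route_count r)%:R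
  - (coord_height d ord0 (r ord0))%:R.
Proof.
have E : \sum_(i < n) trop_coord (multiperm_point K R d) (r (lift ord0 i)) =
    (\sum_(i < n) coord_height d (lift ord0 i) (r (lift ord0 i)))%:R.
  by rewrite natr_sum; apply: eq_bigr => i _; rewrite trop_coord_point.
rewrite trop_termE E big_ord_recl natrD /route_height.
by rewrite [RHS]addrAC (addrC _%:R) addrK addrC.
Qed.

Lemma multiperm_point_clique (R : realType) n (K : 'I_n.+1 -> nat)
    (d : seq 'I_n.+1) : multiperm K d ->
  corresponds_to_clique (route_height K R) d (multiperm_point K R d).
Proof.
move=> dK r rd; apply/attainsP => s s0; rewrite !trop_term_point s0 lerD2r.
rewrite (route_count_clique dK rd) natrD opprD addrCA subrr addr0.
rewrite lerBrDl addrC -lerBrDl opprK -natrD ler_nat addnC.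
exact: route_count_le_coord_height.
Qed.

(** If x and y both correspond to the clique, the sum of the differences
    x_{i,b_i} - y_{i,b_i} depends only on the first edge of the clique route.
    Raising an edge of v_i with i >= 1 keeps the first edge, so
    x_{i,j} - y_{i,j} does not depend on j, and it vanishes for j = 0. *)
Lemma clique_point_unique (R : realType) n (K : 'I_n.+1 -> nat)
    (h : route K -> R) (d : seq 'I_n.+1) (x y : coord_space K R) :
  multiperm K d -> corresponds_to_clique h d x ->
  corresponds_to_clique h d y -> x = y.
Proof.
move=> dK cx cy.
(* Two clique routes that differ at most in the edge leaving v_(i+1). *)
have step r r' i : r \in multiperm_clique K d -> r' \in multiperm_clique K d ->
    (forall k, k != lift ord0 i -> r k = r' k) ->
    trop_coord x (r (lift ord0 i)) - trop_coord y (r (lift ord0 i)) =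
    trop_coord x (r' (lift ord0 i)) - trop_coord y (r' (lift ord0 i)).
  move=> rd r'd rr'.
  have r0 : r ord0 = r' ord0 by apply: rr'; rewrite neq_lift.
  have : trop_term h x r - trop_term h y r
         = trop_term h x r' - trop_term h y r'.
    by rewrite (cx _ rd) (cx _ r'd) (cy _ rd) (cy _ r'd) r0.
  rewrite !trop_termB (bigD1 i) //= [RHS](bigD1 i) //=.
  rewrite (eq_bigr (fun j => trop_coord x (r' (lift ord0 j))
                             - trop_coord y (r' (lift ord0 j)))).
    exact: addIr.
  by move=> j ji; rewrite rr' // (inj_eq lift_inj).
have same i j (b : 'I_(K (lift ord0 i)).+1) : b = j :> nat ->
    trop_coord x b = trop_coord y b.
  elim: j b => [|j IH] b bj.
    by rewrite (_ : b = ord0) ?trop_coord0 //; apply: val_inj.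
  have jd : (j < count_mem (lift ord0 i) d)%N.
    by rewrite dK -bj -ltnS ltn_ord.
  have [u [v [dE cu]]] := split_at_letter jd.
  have dK1 := dK; rewrite dE in dK1; have [r rd rE] := prefix_route dK1.
  have dK2 := dK1; rewrite -cat_rcons in dK2.
  have [s sd sE] := prefix_route dK2.
  rewrite cat_rcons -dE in sd; rewrite -dE in rd.
  have bE : b = s (lift ord0 i).
    by apply: val_inj; rewrite /= sE count_mem_rcons eqxx cu addn1.
  apply/eqP; rewrite -subr_eq0 bE -(step r) //.
    by rewrite IH ?subrr // rE.
  move=> k ki; apply: val_inj; rewrite /= rE sE count_mem_rcons eq_sym.
  by rewrite (negbTE ki) addn0.
apply/ffunP => -[i j]; have := same i _ (lift ord0 j) erefl.
by rewrite /trop_coord liftK.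
Qed.

(** * The vertices of the framingtope *)

Local Open Scope classical_set_scope.

Definition clique_from n (K : 'I_n.+1 -> nat) (d : seq 'I_n.+1)
    (b : 'I_(K ord0).+1) : {set route K} :=
  [set r in multiperm_clique K d | r ord0 == b]%SET.

Lemma clique_cellE (R : realType) n (K : 'I_n.+1 -> nat)
    (h : route K -> R) (d : seq 'I_n.+1) :
  \bigcap_b [set x | forall r, r \in clique_from d b -> attains h x r]
  = [set x | corresponds_to_clique h d x].
Proof.
apply/seteqP; split=> x /= cx.
  by move=> r rd; apply: (cx (r ord0) I); rewrite inE rd eqxx.
by move=> b _ r; rewrite inE => /andP[/cx].
Qed.

Theorem corollary7p13 (R : realType) (n : nat) (K : 'I_n.+1 -> nat) :
  (forall (d : seq 'I_n.+1) (x : coord_space K R), multiperm K d ->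
     corresponds_to_clique (route_height K R) d x <->
     x = multiperm_point K R d) /\
  set_bij [set d : seq 'I_n.+1 | multiperm K d]
          (framingtope_vertices (route_height K R))
          (multiperm_point K R).
Proof.
have char (d : seq 'I_n.+1) (x : coord_space K R) : multiperm K d ->
    corresponds_to_clique (route_height K R) d x <-> x = multiperm_point K R d.
  move=> dK; split=> [cx|->]; last exact: multiperm_point_clique.
  exact: clique_point_unique dK cx (multiperm_point_clique R dK).
split=> //; split.
- move=> d dK; split; last first.
    exists (\sum_q `|multiperm_point K R d q|) => x -> q.
    by rewrite (bigD1 q) //= lerDl sumr_ge0.
  split; first by exists (multiperm_point K R d).
  exists (fun b => [set x | forall r, r \in clique_from d b ->
                      attains (route_height K R) x r]); last first.
    by rewrite clique_cellE; apply/seteqP; split=> x /char; apply.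
  move=> b; exists (clique_from d b); split=> //.
  - have b0 : (b <= count_mem ord0 d)%N by rewrite dK -ltnS ltn_ord.
    have [u [v [dE cu]]] := split_at_count b0.
    have dK' := dK; rewrite /= dE in dK'; have [r rd rE] := prefix_route dK'.
    by exists r; rewrite inE dE rd /=; apply/eqP/val_inj; rewrite /= rE cu.
  - by move=> r; rewrite inE => /andP[_ /eqP].
  - exists (multiperm_point K R d) => r; rewrite inE => /andP[rd _].
    exact: multiperm_point_clique.
- move=> d d' /set_mem dK /set_mem d'K dd'.
  apply: (multiperm_clique_inj dK d'K) => r s rd sd.
  apply: (@attains_comparable R _ _ (multiperm_point K R d)).
    exact: multiperm_point_clique.
  by rewrite dd'; apply: multiperm_point_clique.
- move=> x [[_ [E cellE xE]] _].
  have Ex b : E b x by have : [set x] x by []; rewrite xE; apply.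
  (* The sets of routes that cut out the cell {x}; A is their union. *)
  pose S b := sval (cid (cellE b)).
  have SP b := svalP (cid (cellE b)).
  pose A := [set r : route K | r \in S (r ord0)]%SET.
  have ASx r : r \in A -> attains (route_height K R) x r.
    rewrite inE => rS; have [_ _ EE _] := SP (r ord0).
    by have := Ex (r ord0); rewrite EE; apply.
  have [d dK Ad] := @chain_sub_clique _ K A (fun r s rA sA =>
                      attains_comparable (ASx _ rA) (ASx _ sA)).
  exists d => //.
  (* The clique contains A, so its point lies in the cell {x}. *)
  suff : [set x] (multiperm_point K R d) by [].
  rewrite xE => b _; have [_ S0 -> _] := SP b.
  move=> r rS; apply: multiperm_point_clique => //.
  by apply: Ad; rewrite inE (S0 _ rS).
Qed.
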